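(* Let $\mathcal G$ be a random graph on the vertex set $V$ which satisfies the BK inequality, and suppose that for some $\alpha\in(d/2,d)$ there exists $C>0$ such that $\tau(x,y)\le C\, g_\alpha(x,y)$ for all $x,y\in V$. There exists $c>0$ such that for any $x\in V$, any finite nonempty $A\subset V$, and any $t>0$, $$\mathbb P(|\mathcal C(x)\cap A|>t)\le 2\cdot\exp\Big(-c\cdot\frac{t}{\sup_{y\in V}g_{2\alpha-d}(y,A)}\Big)\le 2\cdot\exp\Big(-c^2\cdot\frac{t}{|A|^{2(1-\frac{\alpha}{d})}}\Big).$$
   Context: $(V,d_V)$ is a countable metric space, with balls $B(x,r)=\{y\in V: d_V(x,y)\le r\}$, of polynomial volume growth: there are a real $d\ge 1$ and constants $c_1,c_2>0$ with $c_1 r^d\le |B(x,r)|\le c_2 r^d$ for all $x\in V$, $r\ge 1$. $\mathcal G$ is a random graph with deterministic vertex set $V$ and possibly random edge set; $\{x\longleftrightarrow y\}$ is the event that $x$ and $y$ are connected in $\mathcal G$, $\tau(x,y)=\mathbb P(x\longleftrightarrow y)$, and $\mathcal C(x)=\{y\in V:x\longleftrightarrow y\}$. For $\beta>0$, $g_\beta(x,y)=\frac{1}{1+d_V(x,y)^\beta}$, and for $A\subset V$, $g_\beta(y,A)=\sum_{z\in A}g_\beta(y,z)$. BK inequality: an event $E$ is increasing if whenever $\{\mathcal G=A\}\subseteq E$ for a fixed graph $A$ with vertex set $V$, then $\{\mathcal G=B\}\subseteq E$ for every graph $B$ on $V$ containing $A$ as a subgraph. A finite graph $A$ witnesses $E$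 if $\{A\subseteq\mathcal G\}\subseteq E$. For increasing events $E,F$, $E\circ F$ is the event that there exist two finite subgraphs of $\mathcal G$ with disjoint edge sets, one witnessing $E$ and the other witnessing $F$. $\mathcal G$ satisfies the BK inequality if $\mathbb P(E\circ F)\le \mathbb P(E)\,\mathbb P(F)$ for all increasing events $E,F$. *)

(* Defs.v *)
From HB Require Import structures.
From mathcomp Require Import all_boot all_order all_algebra finmap.
From mathcomp Require Import all_classical all_reals all_analysis.

Set Implicit Arguments.
Unset Strict Implicit.
Unset Printing Implicit Defensive.
Import Order.TTheory GRing.Theory Num.Theory.

Local Open Scope classical_set_scope.
Local Open Scope ring_scope.

Definition card_set (T : choiceType) (A : set T) : nat := #|` fset_set A|.

Section MetricSpace.
Context {R : realType} {V : metricType R}.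

(* The library's [ball] is the open one. *)
Definition cball (x : V) (r : R) : set V := [set y | mdist x y <= r].

(* Finiteness is stated explicitly because [card_set] is 0 on infinite sets. *)
Definition polynomial_growth (dim : R) : Prop :=
  exists c1 c2 : R, [/\ 0 < c1, 0 < c2 &
    forall (x : V) (r : R), 1 <= r ->
      [/\ finite_set (cball x r),
          c1 * r `^ dim <= (card_set (cball x r))%:R &
          (card_set (cball x r))%:R <= c2 * r `^ dim]].

Definition kernel_g (beta : R) (x y : V) : R := (1 + mdist x y `^ beta)^-1.

Definition kernel_g_set (beta : R) (y : V) (A : set V) : R :=
  \sum_(z \in A) kernel_g beta y z.

End MetricSpace.
Arguments polynomial_growth {R} V dim.

Record graph (V : eqType) := Graph {
  adj :> rel V;
  adj_sym : symmetric adj;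
  adj_irr : irreflexive adj
}.

Definition empty_graph (V : eqType) : graph V :=
  @Graph V (fun _ _ => false) (fun _ _ => erefl) (fun _ => erefl).

HB.instance Definition _ (V : eqType) := gen_eqMixin (graph V).
HB.instance Definition _ (V : eqType) := gen_choiceMixin (graph V).
HB.instance Definition _ (V : eqType) :=
  isPointed.Build (graph V) (empty_graph V).

(* Graphs on V carry the product sigma-algebra, generated by the events that a
   given edge is present. *)
Definition edge_events (V : eqType) : set (set (graph V)) :=
  [set E | exists x y : V, E = [set H : graph V | H x y]].
Arguments edge_events V : clear implicits.

Notation graph_space V := (g_sigma_algebraType (edge_events V)).

Section Graphs.
Context {V : choiceType}.
Implicit Types (H A B : graph V) (E F : set (graph V)).

Definition graph_connected H (x y : V) : Prop :=
  exists p : seq V, path H x p /\ last x p = y.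

Definition graph_cluster H (x : V) : set V := [set y | graph_connected H x y].

Definition subgraph A B : Prop := forall x y : V, A x y -> B x y.

(* Each edge appears here with both orientations, so that finiteness and
   disjointness are those of the sets of unoriented edges. *)
Definition edges H : set (V * V) := [set e | H e.1 e.2].

(* Finite graphs are represented by their extension to the vertex set V by
   isolated vertices, which does not affect inclusion in a graph on V. *)
Definition finite_graph A : Prop := finite_set (edges A).

Definition increasing E : Prop :=
  forall A B, subgraph A B -> E A -> E B.

Definition witnesses A E : Prop := [set H | subgraph A H] `<=` E.

Definition disjoint_occurrence E F : set (graph V) :=
  [set H | exists A B,
    [/\ finite_graph A, finite_graph B & edges A `&` edges B = set0] /\
    [/\ subgraph A H, subgraph B H, witnesses A E & witnesses B F]].

End Graphs.

Section RandomGraph.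
Context {R : realType} {V : choiceType} {disp : measure_display}
  {Omega : measurableType disp} {P : probability Omega R}.
Implicit Types (G : {RV P >-> graph_space V}) (E F : set (graph_space V)).

(* Events are measurable sets of graphs, i.e. subsets of the canonical space on
   which {G = A} is the singleton of A; they are pulled back to Omega by G. *)
Definition satisfies_BK G : Prop :=
  forall E F, measurable E -> measurable F -> increasing E -> increasing F ->
    (P (G @^-1` disjoint_occurrence E F) <= P (G @^-1` E) * P (G @^-1` F))%E.

Definition two_point G (x y : V) : \bar R :=
  P (G @^-1` [set H | graph_connected H x y]).

End RandomGraph.

(* Main.v *)
Require Import Defs.
From mathcomp Require Import all_boot all_order all_algebra finmap.
From mathcomp Require Import all_classical all_reals all_analysis.
From mathcomp Require Import measurable_realfun lra.

(** Write N for the number of points of A in the cluster of x.  The theorem is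
an exponential moment bound followed by Markov's inequality: for a suitable
l of order 1 / S, where S = sup_y g_{2 alpha - d}(y, A), one has
E (1 + l)^N <= 2.

Expanding the power over subsets, (1 + l)^N is the sum of l^|B| over the
sets B of points of A that all lie in the cluster of x, so the generating
function to control is F(x) = sum over nonempty B of l^|B| q(x, B), where
q(x, B) is the probability that x is connected to every point of B.

If |B| >= 2 and x is connected to B, there are a branch point w and a splitting
of B into two nonempty parts such that x is connected to w and w to each part
by three edge-disjoint finite graphs ([branch_point_of_edges],
[reaches_branch]).  Two applications of the BK inequality and a union bound
over w and the splitting give
  q(x, B) <= sum_w sum_{B = D + D'} tau(x, w) q(w, D) q(w, D').
Multiplying by l^|B| and summing over B, the splittings decouple into a square:
  F(x) <= l sum_{a in A} tau(x, a) + sum_w tau(x, w) F(w)^2.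
Truncating F at |B| <= N turns this into an induction on N, by which F is
below any supersolution h of the recursion ([moment_sum_supersolution]).

The function h = 2 l C g_alpha(., A) is a supersolution when
l = 1 / (4 C^2 K S), because of
  sum_w g_alpha(x, w) g_alpha(w, A)^2 <= K S g_alpha(x, A)
([sum_kernel_conv_sq]).  That estimate follows from the triangle inequality,
which trades a product g_alpha(x, w) g_alpha(w, a) for
g_alpha(x, a) (g_alpha(x, w) + g_alpha(w, a)), and from the convolution bound
g_alpha * g_alpha <= K g_{2 alpha - d} ([sum_kernel_conv]), where both
d / 2 < alpha and alpha < d enter.  As h <= 4 l C S, enlarging K makes
F <= 1.

The second inequality of the theorem is the bound S <= K |A|^{1 - b / d} for
b = 2 alpha - d, obtained by splitting the sum over A at the radius |A|^{1/d}
([sum_kernel_card]).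

Sums over V only ever appear over finite duplicate-free lists of vertices, with
bounds independent of the list; the passage to the limit is confined to
[sum_prob_countable_union]. *)

Set Implicit Arguments.
Unset Strict Implicit.
Unset Printing Implicit Defensive.

Import Order.TTheory GRing.Theory Num.Theory.
Local Open Scope classical_set_scope.
Local Open Scope ring_scope.

(** * Graph connectivity *)

Section Connectivity.
Context {V : choiceType}.
Implicit Types (H T D : graph V) (x y z u v w : V).

Lemma connected_refl H x : graph_connected H x x.
Proof. by exists [::]. Qed.

Lemma connected_step H x y z :
  graph_connected H x y -> H y z -> graph_connected H x z.
Proof.
move=> [p [px py]] yz; exists (rcons p z).
by rewrite rcons_path px py last_rcons.
Qed.

Lemma connected_ind H x (Q : V -> Prop) : Q x ->
    (forall u v, graph_connected H x u -> Q u -> H u v -> Q v) ->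
  forall y, graph_connected H x y -> Q y.
Proof.
move=> Qx Qstep y [p [px <-]]; elim/last_ind: p px => [//|p z IH].
rewrite rcons_path last_rcons => /andP[px pz].
by apply: (Qstep _ _ _ (IH px) pz); exists p.
Qed.

Lemma connected_trans H x y z :
  graph_connected H x y -> graph_connected H y z -> graph_connected H x z.
Proof.
move=> xy; apply: (@connected_ind H y (graph_connected H x)) => // u v _.
exact: connected_step.
Qed.

Lemma connected_sym H x y : graph_connected H x y -> graph_connected H y x.
Proof.
apply: (@connected_ind H x (fun y => graph_connected H y x)).
  exact: connected_refl.
move=> u v _ ux uv; apply: connected_trans ux.
by apply: (connected_step (connected_refl H v)); rewrite adj_sym.
Qed.

Lemma connected_subgraph H T x y :
  subgraph H T -> graph_connected H x y -> graph_connected T x y.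
Proof.
move=> HT; apply: connected_ind; first exact: connected_refl.
by move=> u v _ xu uv; apply: connected_step xu (HT _ _ uv).
Qed.

Definition same_edge x y u v : bool :=
  ((u == x) && (v == y)) || ((u == y) && (v == x)).

Lemma same_edgeC x y u v : same_edge x y u v = same_edge x y v u.
Proof. by rewrite /same_edge orbC [(v == x) && _]andbC [(v == y) && _]andbC. Qed.

Section Constructions.
Variable T : graph V.

Fact delete_edge_sym x y :
  symmetric [rel u v | T u v && ~~ same_edge x y u v].
Proof. by move=> u v /=; rewrite adj_sym same_edgeC. Qed.
Fact delete_edge_irr x y :
  irreflexive [rel u v | T u v && ~~ same_edge x y u v].
Proof. by move=> u /=; rewrite adj_irr. Qed.
Definition delete_edge x y : graph V :=
  Graph (delete_edge_sym x y) (delete_edge_irr x y).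

Fact add_edge_sym x y :
  symmetric [rel u v | T u v || (x != y) && same_edge x y u v].
Proof. by move=> u v /=; rewrite adj_sym same_edgeC. Qed.
Fact add_edge_irr x y :
  irreflexive [rel u v | T u v || (x != y) && same_edge x y u v].
Proof.
move=> u /=; rewrite adj_irr /=; apply/negP => /andP[/eqP nxy].
by move=> /orP[]/andP[/eqP u1 /eqP u2]; apply: nxy; rewrite -u1 -u2.
Qed.
Definition add_edge x y : graph V :=
  Graph (add_edge_sym x y) (add_edge_irr x y).

Fact component_sym x :
  symmetric [rel u v | T u v && `[< graph_connected T x u >]].
Proof.
move=> u v /=; rewrite adj_sym; case vu: (T v u) => //=.
apply: asbool_equiv_eq; split=> /connected_step; apply => //.
by rewrite adj_sym.
Qed.
Fact component_irr x :
  irreflexive [rel u v | T u v && `[< graph_connected T x u >]].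
Proof. by move=> u /=; rewrite adj_irr. Qed.
Definition component x : graph V :=
  Graph (component_sym x) (component_irr x).

Fact induced_sym (W : seq V) :
  symmetric [rel u v | [&& T u v, u \in W & v \in W]].
Proof. by move=> u v /=; rewrite adj_sym [(u \in W) && _]andbC. Qed.
Fact induced_irr (W : seq V) :
  irreflexive [rel u v | [&& T u v, u \in W & v \in W]].
Proof. by move=> u /=; rewrite adj_irr. Qed.
Definition induced (W : seq V) : graph V :=
  Graph (induced_sym W) (induced_irr W).

End Constructions.

Lemma component_connected T x y :
  graph_connected T x y -> graph_connected (component T x) x y.
Proof.
apply: connected_ind; first exact: connected_refl.
move=> u v xu xu' uv; apply: connected_step xu' _ => /=.
by rewrite uv; apply/asboolP.
Qed.

(** The vertices joined to one end of the deleted edge are closed under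
adjacency in [T], since crossing the deleted edge leads from one end to the
other. *)
Lemma delete_edge_connected T x y z : graph_connected T x z ->
  graph_connected (delete_edge T x y) x z \/
  graph_connected (delete_edge T x y) y z.
Proof.
apply: (@connected_ind T x (fun z =>
  graph_connected (delete_edge T x y) x z \/
  graph_connected (delete_edge T x y) y z)).
  by left; apply: connected_refl.
move=> u v _ IH uv.
have [/orP[]/andP[_ /eqP->]|nxy] := boolP (same_edge x y u v).
- by right; apply: connected_refl.
- by left; apply: connected_refl.
have uv' : delete_edge T x y u v by rewrite /= uv.
by case: IH => /connected_step/(_ uv'); [left|right].
Qed.

Lemma induced_mono H (W W' : seq V) :
  {subset W <= W'} -> subgraph (induced H W) (induced H W').
Proof. by move=> WW' u v /= /and3P[-> /WW' -> /WW' ->]. Qed.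

(** A connection uses finitely many vertices.  Working with induced subgraphs
makes the finite witnesses of several connections easy to merge, by
concatenating their vertex lists. *)
Lemma induced_connected H x y : graph_connected H x y ->
  exists W, graph_connected (induced H W) x y.
Proof.
apply: (@connected_ind H x (fun y =>
    exists W, graph_connected (induced H W) x y)).
  by exists [::]; apply: connected_refl.
move=> u v xu [W Wu] uv; exists [:: u, v & W].
apply: (@connected_step _ _ u); last by rewrite /= uv !inE !eqxx orbT.
by apply: connected_subgraph Wu; apply: induced_mono => w wW; rewrite !inE wW !orbT.
Qed.

Lemma induced_finite H W : finite_graph (induced H W).
Proof.
apply: (@sub_finite_set _ _ [set` [seq (u, v) | u <- W, v <- W]]).
  move=> [u v] /= /and3P[_ uW vW].
  by apply/allpairsP; exists (u, v).
exact: finite_seq.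
Qed.

End Connectivity.

(** * Branch points *)

Section Branching.
Context {V : choiceType} {I : finType}.
Variable pts : I -> V.
Implicit Types (H T : graph V) (x y z u v w : V) (B : {set I}).

Definition reaches B x : set (graph V) :=
  [set H | forall i, i \in B -> graph_connected H x (pts i)].

Lemma reaches_increasing B x : increasing (reaches B x).
Proof. by move=> H T HT xH i /xH; apply: connected_subgraph. Qed.

(** [B] is reached from [x] through the branch point [w], where it splits into
two nonempty parts: [T0] is the stem, [T1] and [T2] are the branches. *)
Definition branches x B T w B1 (T0 T1 T2 : graph V) : Prop :=
  [/\ B1 \subset B, (0 < #|B1|)%N & (0 < #|B :\: B1|)%N] /\
  [/\ subgraph T0 T, subgraph T1 T & subgraph T2 T] /\
  [/\ edges T0 `&` edges T1 = set0, edges T0 `&` edges T2 = set0 &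
      edges T1 `&` edges T2 = set0] /\
  [/\ graph_connected T0 x w, reaches B1 w T1 & reaches (B :\: B1) w T2].

Lemma branches_subgraph x B T T' w B1 T0 T1 T2 : subgraph T T' ->
  branches x B T w B1 T0 T1 T2 -> branches x B T' w B1 T0 T1 T2.
Proof.
move=> TT' [? [[T0T T1T T2T] ?]]; split=> //; split=> //.
by split=> u v; [move/T0T|move/T1T|move/T2T]; apply: TT'.
Qed.

(** Edges are removed one at a time at the current root [x], so no spanning tree
has to be extracted.  If [x] is one of the points, it is itself the branch
point and one part is that point alone.  Otherwise delete an edge [xy], and let
[J] be the points still connected to [x]; the others are connected to [y].  If
one of these parts is empty, the smaller graph has a branch point seen from [x]
or from [y], and the edge [xy] prolongs the stem in the second case.  If both
are nonempty, [x] and [y] lie in different components of the smaller graph, so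
that [x] is a branch point with the two components as edge-disjoint
branches. *)
Lemma branch_point_of_edges (s : seq (V * V)) T x B :
  (forall u v, T u v -> (u, v) \in s) -> (1 < #|B|)%N -> reaches B x T ->
  exists w B1 T0 T1 T2, branches x B T w B1 T0 T1 T2.
Proof.
have [n] := ubnP (size s); elim: n => // n IH in s T x *.
rewrite ltnS => sn Ts B1 xB.
have e0 (D : graph V) : edges (empty_graph V) `&` edges D = set0.
  by rewrite -subset0 => -[u v] [].
have [[i iB ix]|noi] := pselect (exists2 i, i \in B & pts i = x).
  exists x, [set i]%SET, (empty_graph V), (empty_graph V), T.
  split; last split; last split.
  - by rewrite cardsD (finset.setIidPr _) ?finset.sub1set// cards1 subn_gt0.
  - by split.
  - by split; exact: e0.
  - split; first exact: connected_refl.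
      by move=> j; rewrite inE => /eqP ->; rewrite ix; apply: connected_refl.
    by move=> j; rewrite inE => /andP[_ /xB].
have /card_gt0P[i iB] : (0 < #|B|)%N by exact: ltnW.
have [y xy] : exists y, T x y.
  have [[|y p] [/= px pl]] := xB i iB.
    by case: noi; exists i.
  by exists y; case/andP: px.
have xNy : x != y by apply: contraTneq xy => ->; rewrite adj_irr.
set D := delete_edge T x y.
have DT : subgraph D T by move=> u v /= /andP[].
have nDxy : ~~ D x y by rewrite /= /same_edge !eqxx andbF.
pose s' := [seq e <- s | e != (x, y)].
have Ds u v : D u v -> (u, v) \in s'.
  move=> /= /andP[uv]; rewrite mem_filter Ts// andbT => /norP[+ _].
  by apply: contraNneq => -[-> ->]; rewrite !eqxx.
have s's : (size s' < n)%N.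
  apply: leq_trans sn; rewrite size_filter -(count_predC (pred1 (x, y)) s).
  rewrite -[X in (X < _)%N]add0n ltn_add2r -has_count.
  by apply/hasP; exists (x, y); rewrite ?Ts//=.
have xyB j : j \in B -> graph_connected D x (pts j) \/ graph_connected D y (pts j).
  by move=> /xB; apply: delete_edge_connected.
pose J := [set j in B | `[< graph_connected D x (pts j) >]]%SET.
have JB : J \subset B by apply/fintype.subsetP => j; rewrite inE => /andP[].
have BJy : reaches (B :\: J) y D.
  move=> j; rewrite !inE => /andP[+ jB]; rewrite jB /= => /asboolPn nxj.
  by case: (xyB j jB).
have [J0|Jgt0] := posnP #|J|.
  have yB : reaches B y D.
    move: J0 => /eqP; rewrite cards_eq0 => /eqP J0.
    by move=> j jB; apply: BJy; rewrite J0 finset.setD0.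
  have [w [K [T0 [T1 [T2 [K3 [[T0D T1D T2D] [[d01 d02 d12] [yw w1 w2]]]]]]]]] :=
    IH s' D y s's Ds B1 yB.
  exists w, K, (add_edge T0 x y), T1, T2; split=> //.
  have newedge (D' : graph V) : subgraph D' D -> edges T0 `&` edges D' = set0 ->
      edges (add_edge T0 x y) `&` edges D' = set0.
    move=> D'D dis; rewrite -subset0 => -[u v] [] /= /orP[T0uv D'uv|].
      by move: dis; rewrite -subset0 => /(_ (u, v)); apply.
    by rewrite xNy /= => se /D'D /= /andP[_]; rewrite se.
  split; last split.
  - split; [|by move=> u v /T1D/DT|by move=> u v /T2D/DT].
    move=> u v /= /orP[/T0D/DT//|]; rewrite xNy.
    by move=> /orP[]/andP[/eqP-> /eqP->]//; rewrite adj_sym.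
  - by split => //; apply: newedge.
  - split=> //; apply: connected_trans (connected_subgraph _ yw).
      by apply: (connected_step (connected_refl _ x)); rewrite /= xNy /same_edge !eqxx orbT.
    by move=> u v /= ->.
have [BJ0|BJgt0] := posnP #|B :\: J|.
  have xBD : reaches B x D.
    move=> j jB; apply: contrapT => /asboolPn nj.
    have : j \in B :\: J by rewrite !inE jB /= nj.
    by move: BJ0 => /eqP; rewrite cards_eq0 => /eqP->; rewrite inE.
  have [w [K [T0 [T1 [T2 br]]]]] := IH s' D x s's Ds B1 xBD.
  by exists w, K, T0, T1, T2; apply: branches_subgraph br.
(* The components of x and y differ: a point of B outside J is connected to y
   and would otherwise be connected to x. *)
have nxy : ~ graph_connected D x y.
  move=> cxy; case/card_gt0P: BJgt0 => j; have := BJy j => /[swap] jBJ /(_ jBJ) yj.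
  move: jBJ; rewrite !inE => /andP[+ jB]; rewrite jB /= => /asboolPn; apply.
  exact: connected_trans yj.
exists x, J, (empty_graph V), (component D x), (add_edge (component D y) x y).
split; first by split.
split; last split.
- split=> // u v /=; first by move=> /andP[/andP[]].
  rewrite xNy => /orP[/andP[/andP[]]//|].
  by move=> /orP[]/andP[/eqP-> /eqP->]//; rewrite adj_sym.
- split; [exact: e0|exact: e0|].
  rewrite -subset0 => -[u v] [] /= /andP[/andP[_ nse]] /asboolP xu.
  rewrite /= in nse *; move=> /orP[/andP[_ /asboolP yu]|]; last first.
    by rewrite (negbTE nse) andbF.
  by apply: nxy; apply: connected_trans (connected_sym yu).
- split; first exact: connected_refl.
    move=> j; rewrite inE => /andP[_ /asboolP].
    exact: component_connected.
  move=> j /BJy /component_connected yj.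
  apply: (@connected_trans _ _ _ y).
    by apply: (connected_step (connected_refl _ x)); rewrite /= xNy /same_edge !eqxx orbT.
  by apply: connected_subgraph yj => u v /= ->.
Qed.

Lemma reaches_induced H x B : reaches B x H ->
  exists W, reaches B x (induced H W).
Proof.
move=> xB; suff [W xW] : exists W, forall i, i \in enum B ->
    graph_connected (induced H W) x (pts i).
  by exists W => i iB; apply: xW; rewrite mem_enum.
have : forall i, i \in enum B -> graph_connected H x (pts i).
  by move=> i; rewrite mem_enum; apply: xB.
elim: (enum B) => [|j r IH] xr; first by exists [::].
have [|W xW] := IH; first by move=> i ir; apply: xr; rewrite inE ir orbT.
have [|U xU] := @induced_connected _ H x (pts j); first by apply: xr; rewrite mem_head.
exists (W ++ U) => i; rewrite inE => /orP[/eqP->|/xW].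
  by apply: connected_subgraph xU; apply: induced_mono => w wU; rewrite mem_cat wU orbT.
by apply: connected_subgraph; apply: induced_mono => w wW; rewrite mem_cat wW.
Qed.

Lemma finite_subgraph T T' : subgraph T T' -> finite_graph T' -> finite_graph T.
Proof. by move=> TT'; apply: sub_finite_set => -[u v] /TT'. Qed.

Definition connection x y : set (graph V) := [set H | graph_connected H x y].

(** The form of [branch_point_of_edges] to which the BK inequality applies: the
union of the two branches is a finite witness of the inner disjoint
occurrence, and the stem witnesses the connection to the branch point. *)
Lemma reaches_branch H x B : (1 < #|B|)%N -> reaches B x H ->
  exists w B1, [/\ B1 \subset B, (0 < #|B1|)%N & (0 < #|B :\: B1|)%N] /\
    disjoint_occurrence (connection x w)
      (disjoint_occurrence (reaches B1 w) (reaches (B :\: B1) w)) H.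
Proof.
move=> B1 /reaches_induced[W xW]; set T := induced H W in xW.
have fT : finite_graph T by exact: induced_finite.
have TH : subgraph T H by move=> u v /= /and3P[].
have /finite_seqP[s es] := fT.
have [|w [K [T0 [T1 [T2 [cK [[T0T T1T T2T] [[d01 d02 d12] [xw w1 w2]]]]]]]]] :=
    @branch_point_of_edges s T x B _ B1 xW.
  by move=> u v uv; have : edges T (u, v) by []; rewrite es.
exists w, K; split=> //.
have f0 := finite_subgraph T0T fT.
have f1 := finite_subgraph T1T fT.
have f2 := finite_subgraph T2T fT.
have symU : symmetric [rel u v | T1 u v || T2 u v].
  by move=> u v /=; rewrite adj_sym [T2 u v]adj_sym.
have irrU : irreflexive [rel u v | T1 u v || T2 u v].
  by move=> u /=; rewrite !adj_irr.
pose T12 := Graph symU irrU.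
have T12T : subgraph T12 T by move=> u v /= /orP[/T1T|/T2T].
exists T0, T12; split; split=> //.
- exact: finite_subgraph fT.
- rewrite -subset0 => -[u v] [] /= uv0 /orP[uv1|uv2].
    by move: d01; rewrite -subset0 => /(_ (u, v)); apply.
  by move: d02; rewrite -subset0 => /(_ (u, v)); apply.
- by move=> u v /T0T/TH.
- by move=> u v /T12T/TH.
- by move=> D /= T0D; apply: connected_subgraph xw.
move=> D /= T12D; exists T1, T2; split; split=> //.
- by move=> u v uv; apply: T12D; rewrite /= uv.
- by move=> u v uv; apply: T12D; rewrite /= uv orbT.
- by move=> D' /= T1D'; apply: reaches_increasing w1.
- by move=> D' /= T2D'; apply: reaches_increasing w2.
Qed.

End Branching.

(** * Kernels on a metric space *)

Lemma powR_ge1 (R : realType) (a s : R) : 1 <= a -> 0 <= s -> 1 <= a `^ s.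
Proof. by move=> a1 s0; have := ler_powR a1 s0; rewrite powRr0. Qed.

Lemma powRD_gt0 (R : realType) (a r s : R) :
  0 < a -> a `^ (r + s) = a `^ r * a `^ s.
Proof. by move=> a0; rewrite powRD// (gt_eqF a0) implybT. Qed.

Lemma powR2_gt1 (R : realType) (s : R) : 0 < s -> 1 < (2 : R) `^ s.
Proof.
move=> s0; have h : (1 : R) < 2 by lra.
by have := @gt0_ltr_powR R s s0 1 2; rewrite powR1; apply; rewrite ?nnegrE.
Qed.

Section Kernel.
Context {R : realType} {V : metricType R}.
Implicit Types (x y z w : V) (a b r : R).

Lemma kernel_gt0 b x y : 0 < kernel_g b x y.
Proof. by rewrite /kernel_g invr_gt0 ltr_pwDl// powR_ge0. Qed.

Lemma kernel_ge0 b x y : 0 <= kernel_g b x y.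
Proof. exact/ltW/kernel_gt0. Qed.

Lemma kernel_le1 b x y : kernel_g b x y <= 1.
Proof. by rewrite /kernel_g invf_le1 ?lerDl ?powR_ge0// ltr_pwDl// powR_ge0. Qed.

Lemma kernel_sym b x y : kernel_g b x y = kernel_g b y x.
Proof. by rewrite /kernel_g metric_sym. Qed.

Lemma kernel_diag b x : 0 < b -> kernel_g b x x = 1.
Proof. by move=> b0; rewrite /kernel_g mdistxx powR0 ?gt_eqF// addr0 invr1. Qed.

Lemma kernel_le_powR b r x y : 0 <= b -> 0 < r -> r <= mdist x y ->
  kernel_g b x y <= r `^ (- b).
Proof.
move=> b0 r0 rxy; rewrite powRN /kernel_g lef_pV2 ?posrE ?powR_gt0//; last first.
  by rewrite ltr_pwDl// powR_ge0.
apply: (@le_trans _ _ (mdist x y `^ b)); last by rewrite lerDr.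
by apply: ge0_ler_powR; rewrite ?nnegrE ?mdist_ge0 ?(ltW r0).
Qed.

Lemma kernel_anti b x y z w : 0 <= b -> mdist x y <= mdist z w ->
  kernel_g b z w <= kernel_g b x y.
Proof.
move=> b0 xyzw; rewrite /kernel_g lef_pV2 ?posrE ?ltr_pwDl ?powR_ge0//.
by rewrite lerD2l; apply: ge0_ler_powR; rewrite ?nnegrE ?mdist_ge0.
Qed.

(** With the distance truncated below at 1, a pure power is comparable to the
kernel; this is how scale estimates, valid for radii at least 1, are turned
back into kernels. *)
Lemma powR_max_le_kernel b x y : 0 <= b ->
  (Num.max (mdist x y) 1) `^ (- b) <= 2 * kernel_g b x y.
Proof.
move=> b0; have p0 := powR_ge0 (mdist x y) b.
have k0 : 0 < 1 + mdist x y `^ b by rewrite ltr_pwDl.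
rewrite /kernel_g powRN ler_pdivlMr //.
have [d1|/ltW d1] := leP (mdist x y) 1.
  rewrite powR1 invr1 mul1r.
  have : mdist x y `^ b <= 1 `^ b.
    by apply: ge0_ler_powR; rewrite ?nnegrE ?mdist_ge0.
  rewrite powR1; lra.
have : 1 `^ b <= mdist x y `^ b.
  by apply: ge0_ler_powR; rewrite ?nnegrE ?mdist_ge0.
rewrite powR1 => d2.
have q0 : 0 < mdist x y `^ b by lra.
rewrite mulrC ler_pdivrMr//; lra.
Qed.

Lemma kernel_le_kernel a b x y : 0 <= b -> b <= a ->
  kernel_g a x y <= 2 * kernel_g b x y.
Proof.
move=> b0 ba; apply: le_trans (powR_max_le_kernel x y b0).
have [d1|d1] := leP (mdist x y) 1.
  by rewrite powR1 kernel_le1.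
apply: (@le_trans _ _ (mdist x y `^ (- a))).
  by apply: kernel_le_powR; lra.
by apply: ler_powR; [exact: ltW|lra].
Qed.

Lemma kernel_half a x y z : 0 <= a -> mdist x y <= 2 * mdist z y ->
  kernel_g a z y <= 2 `^ a * kernel_g a x y.
Proof.
move=> a0 h; rewrite /kernel_g ler_pdivlMr ?ltr_pwDl ?powR_ge0//.
rewrite mulrC ler_pdivrMr ?ltr_pwDl ?powR_ge0//.
have h1 : 1 <= 2 `^ a :> R.
  by apply: powR_ge1; lra.
have : mdist x y `^ a <= (2 * mdist z y) `^ a.
  by apply: ge0_ler_powR; rewrite ?nnegrE ?mulr_ge0 ?mdist_ge0.
rewrite powRM ?mdist_ge0//; lra.
Qed.

(** One of [mdist x w] and [mdist w y] is at least half of [mdist x y], so the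
corresponding factor is at most a constant times [kernel_g a x y]. *)
Lemma kernel_product a x y w : 0 <= a ->
  kernel_g a x w * kernel_g a w y <=
  2 `^ a * kernel_g a x y * (kernel_g a x w + kernel_g a w y).
Proof.
move=> a0; have tri := metric_triangle x w y.
have k1 := kernel_ge0 a x w; have k2 := kernel_ge0 a w y.
have k3 := kernel_ge0 a x y; have p0 := powR_ge0 (2 : R) a.
have [h|h] := leP (mdist x w) (mdist w y).
  have : kernel_g a w y <= 2 `^ a * kernel_g a x y by apply: kernel_half => //; lra.
  move/(ler_wpM2l k1) => H; apply: le_trans H _.
  by rewrite mulrC ler_wpM2l ?mulr_ge0// lerDl.
have : kernel_g a w x <= 2 `^ a * kernel_g a y x.
  by apply: kernel_half => //; rewrite (metric_sym y x) (metric_sym w x); lra.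
rewrite [_ w x]kernel_sym [_ y x]kernel_sym.
move/(ler_wpM2r k2) => H; apply: le_trans H _.
by rewrite ler_wpM2l ?mulr_ge0// lerDr.
Qed.

End Kernel.

(** * Kernel sums under polynomial growth *)

Section Growth.
Context {R : realType} {V : metricType R}.
Variables (dim c2 : R).
Hypotheses (dim0 : 0 < dim) (c20 : 0 < c2).
Hypothesis volume : forall (x : V) (r : R), 1 <= r ->
  finite_set (cball x r) /\ (card_set (cball x r))%:R <= c2 * r `^ dim.
Implicit Types (x y z w : V) (ws : seq V) (a b r : R).

Lemma sum_in_ball ws x r (Q : pred V) (f : V -> R) M :
  uniq ws -> 1 <= r -> 0 <= M -> (forall w, Q w -> mdist x w <= r) ->
  (forall w, Q w -> f w <= M) ->
  \sum_(w <- ws | Q w) f w <= c2 * r `^ dim * M.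
Proof.
move=> uws r1 M0 Qball fM; have [fin card] := volume x r1.
apply: (@le_trans _ _ (\sum_(w <- ws | Q w) M)).
  by apply: ler_sum => w; apply: fM.
rewrite big_const_seq iter_addr addr0 -[M *+ _]mulr_natl ler_wpM2r//.
apply: le_trans card; rewrite ler_nat -size_filter.
apply: uniq_leq_size; first exact: filter_uniq.
by move=> w; rewrite mem_filter in_fset_set// inE /= => /andP[/Qball].
Qed.

(** The part of the sum in the shell between [r / 2] and [r] is of order
[r `^ (dim - b)]; since this exponent is positive, the shells grow
geometrically and the last one dominates. *)
Lemma sum_kernel_inner b : 0 <= b -> b < dim ->
  exists2 K : R, 0 < K & forall x ws r, uniq ws -> 1 <= r ->
    \sum_(w <- ws | mdist x w <= r) kernel_g b x w <= K * r `^ (dim - b).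
Proof.
move=> b0 bd.
have q1 : 1 < 2 `^ (dim - b) :> R.
  by apply: powR2_gt1; lra.
set q := 2 `^ (dim - b) in q1.
have p0 : 0 < 2 `^ dim :> R by exact: powR_gt0.
(* K0 bounds one shell, and K = K0 + K / q sums the geometric series. *)
pose K0 := c2 * 2 `^ dim * (2 `^ b + 1).
have K00 : 0 < K0 by rewrite !mulr_gt0// ltr_pwDr// powR_ge0.
exists (K0 / (1 - q^-1)); first by rewrite divr_gt0// subr_gt0 invf_lt1//; lra.
set K := K0 / _.
have KE0 : K * (1 - q^-1) = K0.
  by rewrite divfK// subr_eq0 eq_sym invr_eq1 gt_eqF.
have KE : K = K0 + K * q^-1 by lra.
have q'0 : 0 < q^-1 by rewrite invr_gt0; lra.
have K_gt0 : 0 < K by rewrite divr_gt0// subr_gt0 invf_lt1//; lra.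
have KK0 : K0 <= K by rewrite KE lerDl mulr_ge0// ltW.
have base x ws r : uniq ws -> 1 <= r -> r <= 2 ->
    \sum_(w <- ws | mdist x w <= r) kernel_g b x w <= K * r `^ (dim - b).
  move=> uws r1 r2.
  apply: (@le_trans _ _ (c2 * r `^ dim * 1)).
    by apply: (@sum_in_ball _ x) => // w _; apply: kernel_le1.
  apply: (@le_trans _ _ K0).
    rewrite mulr1; apply: (@le_trans _ _ (c2 * 2 `^ dim)).
      by rewrite ler_pM2l//; apply: ge0_ler_powR; rewrite ?nnegrE; lra.
    rewrite /K0 ler_peMr ?mulr_ge0 ?powR_ge0 ?(ltW c20)//.
    by rewrite lerDr powR_ge0.
  apply: le_trans KK0 _; rewrite ler_peMr ?(ltW K_gt0)//.
  by apply: powR_ge1; lra.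
suff main j : forall x ws r, uniq ws -> 1 <= r -> r <= 2 ^+ j ->
    \sum_(w <- ws | mdist x w <= r) kernel_g b x w <= K * r `^ (dim - b).
  move=> x ws r uws r1.
  apply: (main (Num.bound r)) => //; apply: le_trans (ltW (archi_boundP _)) _; first lra.
  by rewrite -natrX ler_nat; apply: ltnW; apply: ltn_expl.
elim: j => [|j IH] x ws r uws r1; first by rewrite expr0 => ?; apply: base => //; lra.
(* Halving the radius is only allowed while it stays at least 1, where the
   volume bound holds; radii up to 2 use one ball. *)
have [r2 _|r2 rj] := leP r 2; first exact: base.
have r0 : 0 < r by lra.
rewrite (bigID (fun w => mdist x w <= r / 2)) /=.
have -> : \sum_(w <- ws | (mdist x w <= r) && (mdist x w <= r / 2)) kernel_g b x w
    = \sum_(w <- ws | mdist x w <= r / 2) kernel_g b x w.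
  apply: eq_bigl => w; apply/andP/idP => [[]//|h]; split=> //; lra.
have in1 : \sum_(w <- ws | mdist x w <= r / 2) kernel_g b x w <= K * q^-1 * r `^ (dim - b).
  apply: le_trans (IH x ws (r / 2) uws _ _) _; first lra.
    by rewrite ler_pdivrMr// mulrC -exprS.
  rewrite -mulrA ler_pM2l// powRM ?invr_ge0//; last lra.
  rewrite mulrC ler_pM2r ?powR_gt0// -powRN -[2^-1]powR_inv1// -powRrM mulN1r.
  by rewrite powRN -powRN /q.
have in2 : \sum_(w <- ws | (mdist x w <= r) && ~~ (mdist x w <= r / 2)) kernel_g b x w
    <= K0 * r `^ (dim - b).
  apply: (@le_trans _ _ (c2 * r `^ dim * (r / 2) `^ (- b))).
    apply: (@sum_in_ball _ x) => //; [exact: powR_ge0|by move=> w /andP[]|].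
    move=> w /andP[_]; rewrite -ltNge => h.
    by apply: kernel_le_powR => //; lra.
  rewrite powRM ?invr_ge0//; last lra.
  have -> : 2^-1 `^ (- b) = 2 `^ b :> R.
    by rewrite -[2^-1]powR_inv1// -powRrM mulN1r opprK.
  rewrite powRD_gt0; last lra.
  rewrite /K0 -!mulrA ler_pM2l//.
  rewrite mulrA [leRHS]mulrCA [leRHS]mulrA [r `^ dim * _ * _]mulrC mulrA.
  rewrite mulrC -!mulrA.
  have a1 : 0 <= r `^ dim * r `^ (- b) by rewrite mulr_ge0 ?powR_ge0.
  have a2 : 2 `^ b <= 2 `^ dim * (2 `^ b + 1) :> R.
    have ? : 1 <= 2 `^ dim :> R by apply: powR_ge1; lra.
    have ? : 0 <= 2 `^ b :> R by exact: powR_ge0.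
    nra.
  nra.
rewrite KE mulrDl addrC; exact: lerD.
Qed.

(** The complementary estimate: the shell between [r] and [2 * r] contributes
order [r `^ (dim - 2 * a)], whose exponent is negative, so now the first shell
dominates.  The induction is on the number of shells met by the list. *)
Lemma sum_kernel_outer a : dim / 2 < a ->
  exists2 K : R, 0 < K & forall x ws r, uniq ws -> 1 <= r ->
    \sum_(w <- ws | r < mdist x w) kernel_g a x w ^+ 2 <= K * r `^ (dim - 2 * a).
Proof.
move=> da; have a0 : 0 <= a.
  have := dim0; lra.
have q1 : 2 `^ (dim - 2 * a) < 1 :> R.
  have -> : dim - 2 * a = - (2 * a - dim) by lra.
  have h : 1 < 2 `^ (2 * a - dim) :> R.
    by apply: powR2_gt1; lra.
  by rewrite powRN invf_lt1//; lra.
set q := 2 `^ (dim - 2 * a) in q1.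
have q0 : 0 < q by exact: powR_gt0.
pose K0 := c2 * 2 `^ dim.
have K00 : 0 < K0 by rewrite mulr_gt0// powR_gt0.
set K := K0 / (1 - q).
have K_gt0 : 0 < K by rewrite divr_gt0// subr_gt0.
have KE0 : K * (1 - q) = K0 by rewrite divfK// subr_eq0 gt_eqF.
have KE : K = K0 + K * q by lra.
exists K => //.
suff main j : forall x ws r, uniq ws -> 1 <= r ->
    \sum_(w <- ws | (r < mdist x w) && (mdist x w <= 2 ^+ j * r)) kernel_g a x w ^+ 2
      <= K * r `^ (dim - 2 * a).
  move=> x ws r uws r1.
  have [j jP] : exists j, forall w, w \in ws -> mdist x w <= 2 ^+ j * r.
    elim: ws {uws} => [|v ws [j IH]]; first by exists 0%N.
    exists (j + Num.bound (mdist x v))%N => w.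
    rewrite inE => /orP[/eqP->|/IH h].
      apply: (@le_trans _ _ (2 ^+ (j + Num.bound (mdist x v)))); last first.
        by rewrite ler_peMr// exprn_ge0.
      apply: le_trans (ltW (archi_boundP (mdist_ge0 x v))) _.
      rewrite -natrX ler_nat; apply: ltnW.
      by apply: leq_trans (ltn_expl _ (ltnSn 1)) _; rewrite leq_exp2l// leq_addl.
    apply: le_trans h _; rewrite ler_pM2r; last lra.
    by rewrite ler_weXn2l ?leq_addr//; lra.
  apply: le_trans (main j x ws r uws r1).
  rewrite le_eqVlt; apply/orP; left; apply/eqP.
  rewrite big_seq_cond [RHS]big_seq_cond; apply: eq_bigl => w.
  by case: (boolP (w \in ws)) => //= /jP ->; rewrite andbT.
elim: j => [|j IH] x ws r uws r1.
  rewrite big1 => [|w]; first exact: mulr_ge0 (ltW K_gt0) (powR_ge0 _ _).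
  rewrite expr0 mul1r => /andP[h1 h2].
  by move: (lt_le_trans h1 h2); rewrite ltxx.
have r0 : 0 < r by lra.
rewrite (bigID (fun w => mdist x w <= 2 * r)) /=.
have -> : K * r `^ (dim - 2 * a) =
    K0 * r `^ (dim - 2 * a) + K * q * r `^ (dim - 2 * a) by rewrite -mulrDl -KE.
apply: lerD.
  apply: (@le_trans _ _ (c2 * (2 * r) `^ dim * (r `^ (- a) ^+ 2))).
    apply: (@sum_in_ball _ x) => //; [lra|by rewrite exprn_ge0// powR_ge0|by move=> w /andP[]|].
    move=> w /andP[/andP[h _] _]; rewrite ler_pXn2r ?nnegrE ?kernel_ge0 ?powR_ge0//.
    by apply: kernel_le_powR => //; exact: ltW.
  rewrite powRM//; last lra.
  rewrite -(powR_mulrn 2 (powR_ge0 _ _)) -powRrM /K0 -!mulrA ler_pM2l// ler_pM2l ?powR_gt0//.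
  rewrite -powRD_gt0; last lra.
  by rewrite mulNr [a * _]mulrC.
apply: (@le_trans _ _ (K * (2 * r) `^ (dim - 2 * a))); last first.
  by rewrite powRM//; [rewrite /q mulrA|lra].
apply: le_trans (IH x ws (2 * r) uws _); last lra.
rewrite le_eqVlt; apply/orP; left; apply/eqP; apply: eq_bigl => w.
rewrite -ltNge mulrA -exprSr; apply/andP/andP => [[/andP[]]|[]] //.
by move=> h1 h2; split=> //; apply/andP; split=> //; lra.
Qed.

(** By symmetry it suffices to sum over the [w] closer to [x] than to [y].  With
[r] the distance from [x] to [y], truncated at 1: within distance [r] of [x] the
factor [kernel_g a w y] is of order [r `^ (- a)] and the other one is summed by
[sum_kernel_inner]; beyond it the product is at most the square of
[kernel_g a x w], summed by [sum_kernel_outer].  Both give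
[r `^ (dim - 2 * a)]. *)
Lemma sum_kernel_conv a : dim / 2 < a -> a < dim ->
  exists2 K : R, 0 < K & forall x y ws, uniq ws ->
    \sum_(w <- ws) kernel_g a x w * kernel_g a w y <= K * kernel_g (2 * a - dim) x y.
Proof.
move=> da ad; have a0 : 0 <= a by lra.
have [K1 K10 inner] := sum_kernel_inner a0 ad.
have [K2 K20 outer] := sum_kernel_outer da.
have p0 := powR_ge0 (2 : R) a.
have [K3 K30 K3E] : exists2 K3 : R, 0 < K3 & K3 = (2 `^ a * 2) * K1 + K2.
  by eexists; last reflexivity; rewrite ltr_wpDl// !mulr_ge0// ltW.
have half x y ws : uniq ws ->
    \sum_(w <- ws | mdist x w <= mdist w y) kernel_g a x w * kernel_g a w y <=
    2 * K3 * kernel_g (2 * a - dim) x y.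
  move=> uws; set r := Num.max (mdist x y) 1.
  have r1 : 1 <= r by rewrite /r le_max lexx orbT.
  apply: (@le_trans _ _ (K3 * r `^ (dim - 2 * a))); last first.
    have -> : dim - 2 * a = - (2 * a - dim) by lra.
    rewrite -mulrA mulrCA ler_pM2l//.
    by apply: powR_max_le_kernel; lra.
  rewrite (bigID (fun w => mdist x w <= r)) /= K3E mulrDl; apply: lerD.
    apply: (@le_trans _ _ (2 `^ a * 2 * r `^ (- a) *
        \sum_(w <- ws | mdist x w <= r) kernel_g a x w)); last first.
      have -> : dim - 2 * a = - a + (dim - a) by lra.
      rewrite powRD_gt0; last lra.
      rewrite -!mulrA ler_wpM2l// ler_pM2l// mulrCA ler_wpM2l ?powR_ge0//.
      exact: inner.
    rewrite mulr_sumr [leLHS]big_mkcond [leRHS]big_mkcond /=; apply: ler_sum => w _.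
    case: ifPn => [/andP[xw wr]|_]; last first.
      by case: ifP => // _; rewrite !mulr_ge0 ?powR_ge0 ?kernel_ge0.
    rewrite wr mulrC ler_wpM2r ?kernel_ge0//.
    have h : kernel_g a w y <= 2 `^ a * kernel_g a x y.
      by apply: kernel_half => //; have := metric_triangle x w y; lra.
    apply: le_trans h _; rewrite -mulrA ler_wpM2l//.
    rewrite /r; case: (leP (mdist x y) 1) => [_|d1].
      by rewrite powR1; have := kernel_le1 a x y; lra.
    have := @kernel_le_powR _ _ a (mdist x y) x y a0 (lt_trans ltr01 d1) (lexx _).
    by have := powR_ge0 (mdist x y) (- a); lra.
  apply: le_trans (outer x ws r uws r1).
  rewrite [leLHS]big_mkcond [leRHS]big_mkcond /=; apply: ler_sum => w _.
  rewrite -ltNge; case: ifPn => [/andP[xw ->]|_]; last first.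
    by case: ifP => // _; rewrite exprn_ge0 ?kernel_ge0.
  by rewrite expr2 ler_wpM2l ?kernel_ge0// kernel_anti.
exists (2 * K3 + 2 * K3); first lra.
move=> x y ws uws; rewrite (bigID (fun w => mdist x w <= mdist w y)) /= mulrDl.
apply: lerD; first exact: half.
rewrite [_ x y]kernel_sym; apply: le_trans (half y x ws uws).
rewrite [leLHS]big_mkcond [leRHS]big_mkcond /=; apply: ler_sum => w _.
rewrite -ltNge; case: ifPn => [h|_]; last first.
  by case: ifP => // _; rewrite mulr_ge0 ?kernel_ge0.
rewrite (metric_sym y) (metric_sym w x) (ltW h).
by rewrite mulrC [_ w y]kernel_sym [_ x w]kernel_sym.
Qed.

(** This makes [\sum_i kernel_g a x (pts i)] a supersolution, up to scaling, of
the quadratic recursion for connection probabilities.  One factor of the square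
is merged with [kernel_g a x w] by [kernel_product], and the resulting two
convolutions with the other factor are each at most [K * S] once summed over
the points. *)
Lemma sum_kernel_conv_sq a : dim / 2 < a -> a < dim ->
  exists2 K : R, 0 < K & forall (I : finType) (pts : I -> V) (S : R),
    (forall y, \sum_i kernel_g (2 * a - dim) y (pts i) <= S) ->
  forall x ws, uniq ws ->
    \sum_(w <- ws) kernel_g a x w * (\sum_i kernel_g a w (pts i)) ^+ 2 <=
    K * S * \sum_i kernel_g a x (pts i).
Proof.
move=> da ad; have a0 : 0 <= a by lra.
have [K K0 conv] := sum_kernel_conv da ad.
have p0 : 0 < 2 `^ a :> R by exact: powR_gt0.
exists (2 `^ a * K * 2); first by rewrite !mulr_gt0.
move=> I pts S HS x ws uws.
pose g := @kernel_g _ V a; pose h := @kernel_g _ V (2 * a - dim).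
have step i : \sum_(w <- ws) g x w * g w (pts i) * (\sum_j g w (pts j)) <=
    2 `^ a * K * 2 * S * g x (pts i).
  apply: (@le_trans _ _ (\sum_(w <- ws) 2 `^ a * g x (pts i) *
      (\sum_j (g x w * g w (pts j) + g (pts i) w * g w (pts j))))).
    apply: ler_sum => w _.
    under [in leRHS]eq_bigr do rewrite -mulrDl.
    rewrite -mulr_sumr mulrA ler_wpM2r ?sumr_ge0//; first by move=> j _; apply: kernel_ge0.
    by rewrite [g (pts i) w]kernel_sym; apply: kernel_product.
  rewrite -mulr_sumr exchange_big /=.
  apply: (@le_trans _ _ (2 `^ a * g x (pts i) * (\sum_j (K * h x (pts j) + K * h (pts i) (pts j))))).
    rewrite ler_wpM2l ?mulr_ge0 ?kernel_ge0 ?(ltW p0)//.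
    by apply: ler_sum => j _; rewrite big_split; apply: lerD; apply: conv.
  rewrite big_split /= -!mulr_sumr -mulrDr.
  have -> : 2 `^ a * K * 2 * S * g x (pts i) = 2 `^ a * g x (pts i) * (K * (S + S)) by lra.
  rewrite ler_wpM2l ?mulr_ge0 ?kernel_ge0 ?(ltW p0)// ler_pM2l//.
  by apply: lerD; apply: HS.
rewrite mulr_sumr; apply: le_trans (ler_sum _ (fun i _ => step i)).
rewrite exchange_big /=; apply: ler_sum => w _.
by rewrite expr2 mulrA [X in X * _]mulr_sumr mulr_suml.
Qed.

(** The ball of radius [size A `^ dim^-1] has volume of order [size A]:  the
kernel sum over this ball and the contribution of the points of [A] outside of
it have the same order. *)
Lemma sum_kernel_card b : 0 <= b -> b < dim ->
  exists2 K : R, 0 < K & forall (A : seq V) y, uniq A -> (0 < size A)%N ->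
    \sum_(a <- A) kernel_g b y a <= K * (size A)%:R `^ (1 - b / dim).
Proof.
move=> b0 bd; have [K K0 inner] := sum_kernel_inner b0 bd.
exists (K + 1); first lra.
move=> A y uA A0.
set n : R := (size A)%:R.
have n1 : 1 <= n by rewrite /n (_ : 1 = 1%:R)// ler_nat.
set r := n `^ dim^-1.
have r1 : 1 <= r by apply: powR_ge1; rewrite // invr_ge0 ltW.
have r0 : 0 < r by lra.
have rdim : r `^ dim = n by rewrite -powRrM mulVf ?gt_eqF// powRr1//; lra.
have -> : n `^ (1 - b / dim) = r `^ (dim - b).
  by rewrite -powRrM mulrBr mulVf ?gt_eqF// [dim^-1 * b]mulrC.
rewrite (bigID (fun w => mdist y w <= r)) /= mulrDl; apply: lerD; first exact: inner.
rewrite powRD_gt0; last lra.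
rewrite rdim mul1r.
apply: (@le_trans _ _ (\sum_(w <- A) r `^ (- b))).
  rewrite [leLHS]big_mkcond; apply: ler_sum => w _ /=.
  case: ifPn => [|_]; last exact: powR_ge0.
  by rewrite -ltNge => h; apply: kernel_le_powR => //; exact: ltW.
by rewrite big_const_seq count_predT iter_addr addr0 -mulr_natl.
Qed.

End Growth.

(** * Measurability of connection events *)

Lemma countable_seq (T : Type) : countable [set: T] -> countable [set: seq T].
Proof.
move=> /countable_injP[f finj]; apply/countable_injP.
exists (fun p => choice.pickle (map f p)) => p q _ _.
move=> /(pcan_inj choice.pickleK); apply: inj_map => u v.
by apply: finj; rewrite inE.
Qed.

Section Measurability.
Context {V : choiceType}.
Hypothesis hV : countable [set: V].
Implicit Types (E F : set (graph_space V)).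

Lemma countable_enum : exists (g : nat -> option V) (f : V -> nat),
  ocancel g f /\ forall w, g (f w) = Some w.
Proof.
have /countable_injP[f finj] := hV.
exists (fun n => if pselect (exists w, f w = n) is left h
                 then Some (projT1 (cid h)) else None), f.
split=> [n|w].
  by case: pselect => //= h; apply: (projT2 (cid h)).
case: pselect => [h|[]]; last by exists w.
by congr Some; apply: finj; rewrite ?inE//; apply: (projT2 (cid h)).
Qed.

Lemma measurable_edge (u v : V) : measurable [set H : graph_space V | H u v].
Proof. by apply: sub_sigma_algebra; exists u, v. Qed.

Lemma measurable_path (x : V) (p : seq V) :
  measurable [set H : graph_space V | path H x p].
Proof.
elim: p x => [|y p IH] x /=.
  by rewrite (_ : [set _ | _] = setT)//; apply/seteqP; split.
rewrite (_ : [set _ | _] = [set H : graph_space V | H x y] `&` [set H | path H y p]).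
  by apply: measurableI; [exact: measurable_edge|exact: IH].
by apply/seteqP; split=> H /= /andP.
Qed.

Lemma measurable_connection (x y : V) :
  measurable (connection x y : set (graph_space V)).
Proof.
rewrite (_ : connection x y = \bigcup_(p : seq V)
  (if last x p == y then [set H : graph_space V | path H x p] else set0)).
  apply: countable_bigcupT_measurable; first exact: countable_seq.
  by move=> p; case: ifP => // _; apply: measurable_path.
apply/seteqP; split=> [H [p [px py]]|H [p _]].
  by exists p => //; rewrite py eqxx.
by case: eqP => // py px; exists p.
Qed.

Lemma measurable_reaches (I : finType) (pts : I -> V) (B : {set I}) x :
  measurable (reaches pts B x : set (graph_space V)).
Proof.
rewrite (_ : reaches pts B x =
    \bigcap_(i in [set` B]) (connection x (pts i) : set (graph_space V))) //.
apply: fin_bigcap_measurable => [|i _]; last exact: measurable_connection.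
exact: finite_finset.
Qed.

Lemma measurable_contains (s : seq (V * V)) :
  measurable [set H : graph_space V | forall e, e \in s -> H e.1 e.2].
Proof.
rewrite (_ : [set _ | _] =
    \bigcap_(e in [set` s]) [set H : graph_space V | H e.1 e.2]) //.
apply: fin_bigcap_measurable => [|e _]; last exact: measurable_edge.
exact: finite_seq.
Qed.

(** Disjoint occurrence only depends on which pairs of finite graphs are
contained in the random graph, and there are countably many such pairs.  This
allows the BK inequality to be applied to nested disjoint occurrences. *)
Lemma measurable_disjoint_occurrence E F :
  measurable (disjoint_occurrence E F : set (graph_space V)).
Proof.
pose good (s : seq (V * V)) (A : graph V) := edges A = [set` s].
pose ok s1 s2 := exists A B : graph V, [/\ good s1 A, good s2 B,
  edges A `&` edges B = set0, witnesses A E & witnesses B F].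
rewrite (_ : disjoint_occurrence E F =
  \bigcup_(s1 : seq (V * V)) \bigcup_(s2 : seq (V * V))
   (if `[< ok s1 s2 >] then
     [set H : graph_space V | forall e, e \in s1 -> H e.1 e.2] `&`
     [set H : graph_space V | forall e, e \in s2 -> H e.1 e.2] else set0)).
  have countable_edges : countable [set: seq (V * V)].
    by apply: countable_seq; rewrite -setXTT; apply: countableX.
  apply: countable_bigcupT_measurable => [|s1]; first exact: countable_edges.
  apply: countable_bigcupT_measurable => [|s2]; first exact: countable_edges.
  by case: ifP => // _; apply: measurableI; apply: measurable_contains.
apply/seteqP; split=> [H [A [B [[/finite_seqP[s1 As1] /finite_seqP[s2 Bs2] dis]]]]|H].
  move=> [AH BH wA wB]; exists s1 => //; exists s2 => //.
  have -> : `[< ok s1 s2 >] by apply/asboolP; exists A, B.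
  split=> -[u v] /= uv.
    by apply: AH; have : [set` s1] (u, v) by []; rewrite -As1.
  by apply: BH; have : [set` s2] (u, v) by []; rewrite -Bs2.
move=> [s1 _] [s2 _]; case: asboolP => // -[A [B [As Bs dis wA wB]]] [/= H1 H2].
exists A, B; split; split=> //; try by apply/finite_seqP; eexists; eassumption.
- by move=> u v uv; apply: (H1 (u, v)); have : edges A (u, v) by []; rewrite As.
- by move=> u v uv; apply: (H2 (u, v)); have : edges B (u, v) by []; rewrite Bs.
Qed.

Lemma disjoint_occurrence_increasing E F : increasing (disjoint_occurrence E F).
Proof.
move=> H H' HH' [A [B [? [AH BH ? ?]]]]; exists A, B; split=> //.
by split=> // u v; [move/AH|move/BH]; apply: HH'.
Qed.

End Measurability.

(** * Sums over subsets of a finite type *)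

Section FinitePowerset.
Context {R : realType} {I : finType}.
Implicit Types (B D : {set I}).

Lemma sum_powerset_expr (l : R) D :
  \sum_(B : {set I} | B \subset D) l ^+ #|B| = (1 + l) ^+ #|D|.
Proof.
have : \prod_(i : I) ((if i \in D then l else 0) + 1) = (1 + l) ^+ #|D|.
  rewrite (eq_bigr (fun i => if i \in D then 1 + l else 1)); last first.
    by move=> i _; case: ifP => _; rewrite ?add0r// addrC.
  by rewrite -big_mkcond /= prodr_const.
rewrite bigA_distr /= => <-; rewrite big_mkcond /=; apply: eq_bigr => B _.
rewrite (bigID (mem B)) /= [X in _ * X]big1 ?mulr1; last by move=> i /negbTE ->.
rewrite (eq_bigr (fun i => if i \in D then l else 0)); last by move=> i ->.
case: ifPn => [/fintype.subsetP BD|/fintype.subsetPn[i iB iD]].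
  by rewrite (eq_bigr (fun=> l)) ?prodr_const// => i /BD ->.
by rewrite (bigD1 i)//= (negbTE iD) mul0r.
Qed.

Lemma sum_singletons (f : {set I} -> R) :
  \sum_(B : {set I} | #|B| == 1%N) f B = \sum_i f [set i]%SET.
Proof.
rewrite -(big_imset (h := fun i : I => [set i]%SET) f (A := predT)) /=; last first.
  by move=> i j _ _; apply: finset.set1_inj.
apply: eq_bigl => B; apply/cards1P/imsetP => [[i ->]|[i _ ->]].
  by exists i.
by exists i.
Qed.

(** The pair formed by [D] and its complement in [B] determines both [B] and
[D], so every term on the left is a different term of the expanded square; both
parts have at most [N] elements because both are nonempty. *)
Lemma sum_splits_le (f : {set I} -> R) N : (forall B, 0 <= f B) ->
  \sum_(B : {set I} | (1 < #|B| <= N.+1)%N)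
   \sum_(D : {set I} | [&& D \subset B, (0 < #|D|)%N & (0 < #|B :\: D|)%N])
     f D * f (B :\: D) <=
  (\sum_(B : {set I} | (0 < #|B| <= N)%N) f B) ^+ 2.
Proof.
move=> f0.
rewrite pair_big_dep /= expr2 big_distrlr pair_big /=.
pose h (p : {set I} * {set I}) := (p.2, p.1 :\: p.2).
pose Q := [pred p : {set I} * {set I} | (1 < #|p.1| <= N.+1)%N &&
   [&& p.2 \subset p.1, (0 < #|p.2|)%N & (0 < #|p.1 :\: p.2|)%N]].
rewrite -(big_imset (h := h) (fun p => f p.1 * f p.2) (A := Q)) /=; last first.
  move=> [B D] [B' D'] /andP[_ /and3P[/= DB _ _]] /andP[_ /and3P[/= DB' _ _]] [eD e].
  rewrite -eD in DB' e *; congr pair.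
  rewrite -(finset.setID B D) -(finset.setID B' D) e.
  by rewrite (finset.setIidPr DB) (finset.setIidPr DB').
rewrite big_mkcond [leRHS]big_mkcond; apply: ler_sum => -[B1 B2] _ /=.
case: ifPn => [/imsetP[[B D] /andP[/= /andP[_ BN] /and3P[DB D0 BD0]] [-> ->]]|_]; last first.
  by case: ifP => // _; apply: mulr_ge0.
rewrite D0 BD0 /=.
have e : (#|D| + #|B :\: D|)%N = #|B|.
  by rewrite -(cardsID D B) (finset.setIidPr DB).
have -> : (#|D| <= N)%N.
  by rewrite -ltnS; apply: leq_trans BN; rewrite -e -[X in (X < _)%N]addn0 ltn_add2l.
have -> // : (#|B :\: D| <= N)%N.
by rewrite -ltnS; apply: leq_trans BN; rewrite -e -[X in (X < _)%N]add0n ltn_add2r.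
Qed.

End FinitePowerset.

(** * Union bounds and Markov's inequality *)

Section ProbabilityInequalities.
Context {R : realType} {disp : measure_display} {Omega : measurableType disp}.
Variable P : probability Omega R.
Implicit Types X Y : set Omega.

Definition prob X : R := fine (P X).

Lemma probE X : measurable X -> (prob X)%:E = P X.
Proof. by move=> mX; rewrite fineK// fin_num_measure. Qed.

Lemma prob_ge0 X : 0 <= prob X.
Proof. exact: fine_ge0. Qed.

Lemma prob_le X Y : measurable X -> measurable Y -> X `<=` Y -> prob X <= prob Y.
Proof. by move=> mX mY XY; rewrite -lee_fin !probE// le_measure ?inE. Qed.

Lemma prob_finite_union (J : finType) (Q : pred J) (X : J -> set Omega) Y :
  measurable Y -> (forall j, Q j -> measurable (X j)) ->
  Y `<=` \bigcup_(j in [set j | Q j]) X j ->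
  prob Y <= \sum_(j | Q j) prob (X j).
Proof.
move=> mY mX YX.
have [mU leU] : measurable (\big[setU/set0]_(j | Q j) X j) /\
    prob (\big[setU/set0]_(j | Q j) X j) <= \sum_(j | Q j) prob (X j).
  apply: (big_ind2 (fun S r => measurable S /\ prob S <= r)).
  - by rewrite /prob measure0.
  - move=> S r S' r' [mS Sr] [mS' Sr']; split; first exact: measurableU.
    apply: le_trans (lerD Sr Sr'); rewrite -lee_fin EFinD !probE//.
      exact: measureU2.
    exact: measurableU.
  - by move=> j Qj; split=> //; apply: mX.
apply: le_trans leU; apply: prob_le => // w /YX[j Qj Xj].
by rewrite -bigcup_seq_cond; exists j; rewrite /= ?mem_index_enum.
Qed.

(** Simultaneous union bounds over a countable type.  Only finite partial sums
are bounded in the hypothesis, uniformly, after summation over [j]: since the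
union bounds for all [j] run along the same enumeration of [U], their weighted
sum is a limit of such partial sums. *)
Lemma sum_prob_countable_union (U : choiceType) (J : finType) (Q : pred J)
    (l : J -> R) (X : J -> set Omega) (E : J -> U -> set Omega)
    (u : J -> U -> R) (M : R) :
  countable [set: U] ->
  (forall j, 0 <= l j) ->
  (forall j, measurable (X j)) -> (forall j w, measurable (E j w)) ->
  (forall j, Q j -> X j `<=` \bigcup_w E j w) ->
  (forall j w, prob (E j w) <= u j w) ->
  (forall ws, uniq ws -> \sum_(w <- ws) \sum_(j | Q j) l j * u j w <= M) ->
  \sum_(j | Q j) l j * prob (X j) <= M.
Proof.
move=> cU l0 mX mE XE Eu uM.
have [g [f [gfK fK]]] := countable_enum cU.
have u0 j w : 0 <= u j w by apply: le_trans (Eu j w); apply: prob_ge0.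
pose v j n : \bar R := (oapp (u j) 0 (g n))%:E.
have v0 j n : (0 <= v j n)%E by rewrite lee_fin; case: (g n) => //=.
have Xv j : Q j -> (P (X j) <= \sum_(0 <= n <oo) v j n)%E.
  move=> Qj; pose F n := oapp (E j) set0 (g n).
  have mF n : measurable (F n) by rewrite /F; case: (g n) => /=.
  apply: (@le_trans _ _ (\sum_(0 <= n <oo) P (F n))%E).
    apply: measure_sigma_subadditive => // w /(XE _ Qj)[a _ Ea].
    by exists (f a) => //; rewrite /F fK.
  apply: lee_nneseries => // n _; rewrite /F /v; case: (g n) => [a|] /=.
    by rewrite -probE// lee_fin.
  by rewrite measure0.
rewrite -lee_fin -sumEFin.
apply: (@le_trans _ _ (\sum_(j | Q j) \sum_(0 <= n <oo) (l j)%:E * v j n)%E).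
  apply: lee_sum => j Qj; rewrite EFinM probE// nneseriesZl//.
  by apply: lee_wpmul2l; rewrite ?lee_fin//; apply: Xv.
rewrite -nneseries_sum; last by move=> j n Qj; rewrite mule_ge0// lee_fin.
apply: lime_le.
  apply: is_cvg_nneseries => n _ _; apply: sume_ge0 => j _.
  by rewrite mule_ge0// lee_fin.
apply: nearW => N.
have -> : (\sum_(0 <= n < N) \sum_(j | Q j) (l j)%:E * v j n)%E =
    (\sum_(w <- pmap g (index_iota 0 N)) \sum_(j | Q j) l j * u j w)%:E.
  elim: (index_iota 0 N) => [|n s IH]; first by rewrite !big_nil.
  rewrite big_cons IH /= /v; case: (g n) => [a|] /=.
    rewrite big_cons EFinD; congr (_ + _)%E; rewrite -sumEFin.
    by apply: eq_bigr => j _; rewrite EFinM.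
  by rewrite big1 ?add0e// => j _; rewrite mule0.
by rewrite lee_fin; apply: uM; apply: pmap_uniq gfK _ _; apply: iota_uniq.
Qed.

(** Markov's inequality for a nonnegative combination of indicators that is at
least [s] on [X]. *)
Lemma prob_markov_sum (J : finType) (l : J -> R) (E : J -> set Omega) X (s : R) :
  measurable X -> (forall j, measurable (E j)) -> (forall j, 0 <= l j) ->
  0 <= s -> (forall w, X w -> s <= \sum_(j | w \in E j) l j) ->
  s * prob X <= \sum_j l j * prob (E j).
Proof.
move=> mX mE l0 s0 sX.
have intI (c : R) Y : 0 <= c -> measurable Y ->
    (\int[P]_w (c%:E * (\1_Y w)%:E))%E = (c * prob Y)%:E.
  move=> c0 mY; rewrite ge0_integralZl_EFin//.
  - by rewrite integral_indic// setIT EFinM probE.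
  - by apply/measurable_EFinP; exact: measurable_indic.
have mI (c : R) Y : measurable Y ->
    measurable_fun setT (fun w => c%:E * (\1_Y w)%:E)%E.
  move=> mY; apply: emeasurable_funM => //.
  by apply/measurable_EFinP; exact: measurable_indic.
rewrite -lee_fin -sumEFin -intI//.
under eq_bigr do rewrite -intI//.
rewrite -ge0_integral_sum//; [|by move=> j; apply: mI|]; last first.
  by move=> j w _; rewrite mule_ge0// lee_fin.
apply: ge0_le_integral => //.
- by move=> w _; rewrite mule_ge0// lee_fin.
- exact: mI.
- by apply: emeasurable_sum => j; apply: mI.
move=> w _.
have -> : (\sum_j (l j)%:E * (\1_(E j) w)%:E)%E = (\sum_(j | w \in E j) l j)%:E.
  rewrite -sumEFin [RHS]big_mkcond; apply: eq_bigr => j _.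
  by rewrite indicE; case: (w \in E j); rewrite ?mule1 ?mule0.
rewrite indicE; case: (boolP (w \in X)) => [|_].
  by rewrite inE mule1 lee_fin => /sX.
by rewrite mule0 lee_fin sumr_ge0.
Qed.

End ProbabilityInequalities.

(** * The recursion for connection probabilities *)

Section Recursion.
Context {R : realType} {V : choiceType} {disp : measure_display}
  {Omega : measurableType disp} {P : probability Omega R}.
Hypothesis hV : countable [set: V].
Variable G : {RV P >-> graph_space V}.
Hypothesis hBK : satisfies_BK G.
Variable k : V -> V -> R.
Hypothesis hk : forall x y, (two_point G x y <= (k x y)%:E)%E.
Context {I : finType}.
Variable pts : I -> V.
Implicit Types (B D : {set I}) (x w : V).

Definition prob_reaches x B : R := prob P (G @^-1` reaches pts B x).

Lemma measurable_preimage (E : set (graph_space V)) :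
  measurable E -> measurable (G @^-1` E).
Proof. by move=> mE; rewrite -[X in measurable X]setTI; apply: measurable_funP. Qed.

Lemma BK_prob (E F : set (graph_space V)) : measurable E -> measurable F ->
  increasing E -> increasing F ->
  prob P (G @^-1` disjoint_occurrence E F) <=
  prob P (G @^-1` E) * prob P (G @^-1` F).
Proof.
move=> mE mF iE iF; rewrite -lee_fin EFinM !probE; first exact: hBK.
all: apply: measurable_preimage => //; exact: measurable_disjoint_occurrence.
Qed.

Lemma prob_connection_le x y : prob P (G @^-1` connection x y) <= k x y.
Proof.
rewrite -lee_fin probE; first exact: hk.
by apply: measurable_preimage; apply: measurable_connection.
Qed.

Lemma prob_branch_le x w B D :
  prob P (G @^-1` disjoint_occurrence (connection x w)
    (disjoint_occurrence (reaches pts B w) (reaches pts D w))) <=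
  k x w * (prob_reaches w B * prob_reaches w D).
Proof.
have mB E := measurable_reaches hV pts E w.
have iB E := @reaches_increasing _ _ pts E w.
apply: le_trans (BK_prob (measurable_connection hV x w)
  (measurable_disjoint_occurrence hV _ _) _
  (@disjoint_occurrence_increasing _ _ _)) _.
  by move=> H T HT; apply: connected_subgraph.
apply: ler_pM; rewrite ?prob_ge0 ?prob_connection_le//.
exact: BK_prob.
Qed.

(** Truncation of E[(1 + l) ^+ n] - 1, where n is the number of indices [i]
such that [x] is connected to [pts i]: expanding the power gives one term for
each set of such indices. *)
Definition moment_sum (l : R) N x : R :=
  \sum_(B : {set I} | (0 < #|B| <= N)%N) l ^+ #|B| * prob_reaches x B.

(** The terms with at least two points.  After the union bound over branch
points [w] and splittings, [l ^+ #|B|] factorizes along the splitting and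
[sum_splits_le] bounds the contribution of [w] by a square. *)
Lemma moment_sum_branch (l : R) N x M : 0 <= l ->
  (forall ws, uniq ws -> \sum_(w <- ws) k x w * moment_sum l N w ^+ 2 <= M) ->
  \sum_(B : {set I} | (1 < #|B| <= N.+1)%N) l ^+ #|B| * prob_reaches x B <= M.
Proof.
move=> l0 hM.
have k0 w : 0 <= k x w by apply: le_trans (prob_connection_le x w); apply: prob_ge0.
pose sub B := [pred D : {set I} |
  [&& D \subset B, (0 < #|D|)%N & (0 < #|B :\: D|)%N]].
pose X w B D := G @^-1` disjoint_occurrence (connection x w)
  (disjoint_occurrence (reaches pts D w) (reaches pts (B :\: D) w)).
have mX w B D : measurable (X w B D).
  by apply: measurable_preimage; apply: measurable_disjoint_occurrence.
pose E B w := \bigcup_(D in [set D | sub B D]) X w B D.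
have mE B w : measurable (E B w).
  by apply: fin_bigcup_measurable.
pose u B w := \sum_(D | sub B D) k x w * (prob_reaches w D * prob_reaches w (B :\: D)).
apply: (@sum_prob_countable_union _ _ _ P V _ _ (fun B => l ^+ #|B|)
  (fun B => G @^-1` reaches pts B x) E u) => //.
- by move=> B; apply: exprn_ge0.
- by move=> B; apply: measurable_preimage; apply: measurable_reaches.
- move=> B /andP[B1 _] omega /= /(reaches_branch B1)[w [D [cD dis]]].
  by exists w => //; exists D => //=; apply/and3P.
- move=> B w; apply: le_trans (_ : _ <= \sum_(D | sub B D) prob P (X w B D)) _.
    exact: prob_finite_union.
  by apply: ler_sum => D _; apply: prob_branch_le.
move=> ws uws; apply: le_trans (hM ws uws); apply: ler_sum => w _.
have f0 B : 0 <= l ^+ #|B| * prob_reaches w B.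
  by rewrite mulr_ge0 ?exprn_ge0 ?prob_ge0.
apply: le_trans (ler_wpM2l (k0 w) (sum_splits_le N f0)).
rewrite mulr_sumr le_eqVlt; apply/orP; left; apply/eqP; apply: eq_bigr => B _.
rewrite /u !mulr_sumr; apply: eq_bigr => D /and3P[DB _ _].
have -> : #|B| = (#|D| + #|B :\: D|)%N.
  by rewrite -(cardsID D B) (finset.setIidPr DB).
rewrite exprD; move: (l ^+ _) (l ^+ _) (k x w) (prob_reaches _ _) (prob_reaches _ _).
by move=> a b c d e; lra.
Qed.

(** The truncation level makes the recursive inequality well founded: sets of at
most [N.+1] points split into parts of at most [N] points.  Singletons give the
linear term, and the larger sets are bounded by [moment_sum_branch]. *)
Lemma moment_sum_supersolution (l : R) (h : V -> R) : 0 <= l ->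
  (forall x, 0 <= h x) ->
  (forall x ws, uniq ws ->
    l * (\sum_i k x (pts i)) + \sum_(w <- ws) k x w * h w ^+ 2 <= h x) ->
  forall N x, moment_sum l N x <= h x.
Proof.
move=> l0 h0 hh; elim=> [|N IH] x.
  by rewrite /moment_sum big1// => B; rewrite leqn0 => /andP[]; case: #|B|.
have k0 w : 0 <= k x w by apply: le_trans (prob_connection_le x w); apply: prob_ge0.
have F0 w : 0 <= moment_sum l N w.
  by apply: sumr_ge0 => B _; rewrite mulr_ge0 ?exprn_ge0 ?prob_ge0.
rewrite /moment_sum (bigID (fun B : {set I} => #|B| == 1%N)) /=.
have -> : \sum_(B : {set I} | (0 < #|B| <= N.+1)%N && (#|B| == 1%N))
    l ^+ #|B| * prob_reaches x B = \sum_i l * prob_reaches x [set i]%SET.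
  transitivity (\sum_i l ^+ #|[set i]%SET| * prob_reaches x [set i]%SET).
    rewrite -(sum_singletons (fun B => l ^+ #|B| * prob_reaches x B)).
    by apply: eq_bigl => B; apply: andb_idl => /eqP ->.
  by apply: eq_bigr => i _; rewrite cards1 expr1.
have -> : \sum_(B : {set I} | (0 < #|B| <= N.+1)%N && (#|B| != 1%N))
    l ^+ #|B| * prob_reaches x B =
    \sum_(B : {set I} | (1 < #|B| <= N.+1)%N) l ^+ #|B| * prob_reaches x B.
  by apply: eq_bigl => B; case: #|B| => [|[|n]] //=; rewrite ?andbF ?andbT.
have single : \sum_i l * prob_reaches x [set i]%SET <= l * \sum_i k x (pts i).
  rewrite mulr_sumr; apply: ler_sum => i _; apply: ler_wpM2l => //.
  apply: le_trans (prob_connection_le x (pts i)); apply: prob_le.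
  - by apply: measurable_preimage; apply: measurable_reaches.
  - by apply: measurable_preimage; apply: measurable_connection.
  - by move=> omega /= /(_ i); apply; rewrite inE.
suff branch : \sum_(B : {set I} | (1 < #|B| <= N.+1)%N) l ^+ #|B| * prob_reaches x B
    <= h x - l * \sum_i k x (pts i) by lra.
apply: (@moment_sum_branch l N) => // ws uws.
have := hh x ws uws; suff : \sum_(w <- ws) k x w * moment_sum l N w ^+ 2 <=
    \sum_(w <- ws) k x w * h w ^+ 2 by lra.
apply: ler_sum => w _; apply: ler_wpM2l => //.
by rewrite ler_pXn2r ?nnegrE.
Qed.

Lemma expR_half_le (l : R) : 0 <= l <= 1 -> expR (l / 2) <= 1 + l.
Proof.
move=> /andP[l0 l1]; have := expR_ge1Dx (- (l / 2)); rewrite expRN => h.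
have e0 := expR_gt0 (l / 2).
have : (1 - l / 2) * expR (l / 2) <= 1.
  by rewrite -ler_pdivlMr// mul1r.
nra.
Qed.

(** Markov's inequality for [(1 + l) ^+ n], which is at least
[expR (l / 2 * t)] when at least [t] points are reached; its expectation is
at most 2, the empty set contributing at most 1 and the nonempty sets at most 1
by hypothesis. *)
Lemma reached_count_tail (l : R) x t (X : set Omega) : 0 <= l <= 1 -> 0 <= t ->
  moment_sum l #|I| x <= 1 -> measurable X ->
  (forall omega, X omega -> exists2 D : {set I},
      reaches pts D x (G omega) & t <= #|D|%:R) ->
  expR (l / 2 * t) * prob P X <= 2.
Proof.
move=> l01 t0 hF mX XD; have /andP[l0 l1] := l01.
apply: (@le_trans _ _ (\sum_(B : {set I}) l ^+ #|B| * prob_reaches x B)).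
  apply: prob_markov_sum => //.
  - by move=> B; apply: measurable_preimage; apply: measurable_reaches.
  - by move=> B; apply: exprn_ge0.
  move=> omega /XD[D xD tD].
  apply: (@le_trans _ _ (\sum_(B : {set I} | B \subset D) l ^+ #|B|)).
    rewrite sum_powerset_expr.
    apply: (@le_trans _ _ (expR (l / 2) ^+ #|D|)).
      rewrite -expRM_natr ler_expR ler_wpM2l//; lra.
    by apply: lerXn2r; rewrite ?nnegrE ?expR_ge0 ?expR_half_le//; lra.
  rewrite big_mkcond [leRHS]big_mkcond; apply: ler_sum => B _.
  case: ifP => [/fintype.subsetP BD|_]; last by case: ifP => // _; apply: exprn_ge0.
  suff -> : omega \in (G @^-1` reaches pts B x) by [].
  by rewrite inE => i /BD; apply: xD.
rewrite (bigD1 finset.set0) //= cards0 expr0 mul1r.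
have -> : \sum_(B : {set I} | B != finset.set0) l ^+ #|B| * prob_reaches x B
    = moment_sum l #|I| x.
  by apply: eq_bigl => B; rewrite max_card andbT card_gt0.
have : prob_reaches x finset.set0 <= 1.
  rewrite -lee_fin probE; last by apply: measurable_preimage; apply: measurable_reaches.
  by apply: probability_le1; apply: measurable_preimage; apply: measurable_reaches.
lra.
Qed.

End Recursion.

(** * Tail of the cluster count *)

(** Indexing the points of [A] by the finite type attached to its list of
elements turns cluster counts into cardinals of subsets of that type. *)
Lemma card_cluster_reaches (V : choiceType) (A : set V) (x : V) (H : graph V) :
  finite_set A -> exists2 D : {set fset_set A},
    reaches (fun a : fset_set A => \val a) D x H &
    (card_set (graph_cluster H x `&` A) <= #|D|)%N.
Proof.
move=> fA; pose D : {set fset_set A} :=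
  [set a : fset_set A | `[< graph_connected H x (\val a) >]]%SET.
exists D; first by move=> a; rewrite inE => /asboolP.
rewrite cardE -(size_map (fun a : fset_set A => \val a)).
apply: uniq_leq_size; first exact: fset_uniq.
have fCA : finite_set (graph_cluster H x `&` A) by apply: finite_setIr.
move=> y; rewrite in_fset_set// inE => -[xy Ay].
have yA : y \in fset_set A by rewrite in_fset_set// inE.
apply/mapP; exists [` yA]%fset => //.
by rewrite mem_enum inE; apply/asboolP.
Qed.

Lemma measurable_cluster_tail (R : realType) (V : choiceType) (A : set V)
    (x : V) (t : R) : countable [set: V] -> finite_set A ->
  measurable [set H : graph_space V |
    t < (card_set (graph_cluster H x `&` A))%:R].
Proof.
move=> hV fA.
pose r (B : {set fset_set A}) := reaches (fun a : fset_set A => \val a) B x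
  : set (graph_space V).
rewrite (_ : [set _ | _] = \bigcup_(B in [set B : {set fset_set A} | t < #|B|%:R]) r B).
  apply: fin_bigcup_measurable => [|B _]; last exact: measurable_reaches.
  exact: finite_finset.
apply/seteqP; split=> [H /= tH|H /= [B tB xB]].
  have [D xD le] := card_cluster_reaches x H fA.
  by exists D => //=; apply: lt_le_trans tH _; rewrite ler_nat.
apply: lt_le_trans tB _; rewrite ler_nat cardE.
have fCA : finite_set (graph_cluster H x `&` A) by apply: finite_setIr.
rewrite -(size_map (fun a : fset_set A => \val a)).
apply: uniq_leq_size; first by rewrite map_inj_uniq ?enum_uniq//; apply: val_inj.
move=> y /mapP[a]; rewrite mem_enum => /xB xa ->.
rewrite in_fset_set// inE; split=> //.
by have := valP a; rewrite in_fset_set// inE.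
Qed.

Theorem corollary1p4 (R : realType) (V : metricType R) (dim : R)
    (hV : countable [set: V]) (hdim : 1 <= dim)
    (hgrowth : polynomial_growth V dim)
    (disp : measure_display) (Omega : measurableType disp)
    (P : probability Omega R) (G : {RV P >-> graph_space V})
    (hBK : satisfies_BK G)
    (alpha : R) (halpha : dim / 2 < alpha < dim)
    (htau : exists2 C : R, 0 < C &
       forall x y : V, (two_point G x y <= (C * kernel_g alpha x y)%:E)%E) :
  exists2 c : R, 0 < c &
    forall (x : V) (A : set V) (t : R),
      finite_set A -> A !=set0 -> 0 < t ->
      let tail :=
        2 * expR (- c * (t / sup [set kernel_g_set (2 * alpha - dim) y A
                                 | y in [set: V]])) in
      (P (G @^-1` [set H | (t < (card_set (graph_cluster H x `&` A))%:R)%R])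
         <= tail%:E)%E /\
      tail <= 2 * expR (- c ^+ 2 *
                (t / (card_set A)%:R `^ (2 * (1 - alpha / dim)))).
Proof.
have [c1 [c2 [_ c20 growth]]] := hgrowth.
have volume (x : V) (r : R) : 1 <= r ->
    finite_set (cball x r) /\ (card_set (cball x r))%:R <= c2 * r `^ dim.
  by move=> /(growth x)[? _ ?].
have /andP[da ad] := halpha; have [C C0 tauC] := htau.
have dim0 : 0 < dim by lra.
set b := 2 * alpha - dim.
have b0 : 0 < b by rewrite /b; lra.
have ba : b <= alpha by rewrite /b; lra.
have bd : b < dim by rewrite /b; lra.
have [K1 K10 conv] := sum_kernel_conv_sq dim0 c20 volume da ad.
have [K2 K20 cardS] := sum_kernel_card dim0 c20 volume (ltW b0) bd.
(* The added terms ensure C * K >= 1, which bounds the generating function by 1,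
   and C ^+ 2 * K >= 1, which makes l at most 1. *)
pose K := K1 + C^-1 + C^-1 ^+ 2.
have iC : 0 < C^-1 by rewrite invr_gt0.
have iC2 : 0 < C^-1 ^+ 2 by rewrite exprn_gt0.
have KK1 : K1 <= K by rewrite /K; lra.
have K0 : 0 < K by lra.
have CiC : C * C^-1 = 1 by rewrite divff// gt_eqF.
have CK : 1 <= C * K.
  by rewrite /K !mulrDr CiC; have := mulr_gt0 C0 K10; have := mulr_gt0 C0 iC2; lra.
have C20 : 0 < C ^+ 2 by rewrite exprn_gt0.
have C2K : 1 <= C ^+ 2 * K.
  rewrite /K !mulrDr -exprMn CiC expr1n.
  by have := mulr_gt0 C20 K10; have := mulr_gt0 C20 iC; lra.
pose L := 4 * (C ^+ 2 * K).
have L4 : 4 <= L by rewrite /L; lra.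
(* The first summand serves the first inequality, where the rate is l / 2, and
   the second one the comparison of S with the power of the cardinal. *)
pose c := (2 * L + K2)^-1.
have c0 : 0 < c by rewrite invr_gt0; lra.
exists c => // x A t fA [a Aa] t0 tail.
set S := sup _ in tail *.
pose I := fset_set A; pose pts (i : I) : V := \val i.
have sumE be y : \sum_(i : I) kernel_g be y (pts i) = kernel_g_set be y A.
  by rewrite /kernel_g_set fsbig_finite// big_seq_fsetE.
have aA : a \in fset_set A by rewrite in_fset_set// inE.
have Abound y : kernel_g_set b y A <= K2 * (card_set A)%:R `^ (2 * (1 - alpha / dim)).
  rewrite /kernel_g_set fsbig_finite//.
  have -> : 2 * (1 - alpha / dim) = 1 - b / dim.
    by rewrite /b mulrBl divff ?gt_eqF//; lra.
  apply: cardS; first exact: fset_uniq.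
  by rewrite -has_predT; apply/hasP; exists a.
have hubS : has_ubound [set kernel_g_set b y A | y in [set: V]].
  by eexists=> _ [y _ <-]; apply: Abound.
have leS y : kernel_g_set b y A <= S by apply: ub_le_sup => //; exists y.
have Sle : S <= K2 * (card_set A)%:R `^ (2 * (1 - alpha / dim)).
  by apply: ge_sup => [|_ [y _ <-]//]; exists (kernel_g_set b a A), a.
have S1 : 1 <= S.
  apply: le_trans (leS a); rewrite -sumE.
  rewrite (bigD1 [` aA]%fset)//= /pts/= kernel_diag// lerDl.
  by apply: sumr_ge0 => i _; apply: kernel_ge0.
have S0 : 0 < S by lra.
(* With this l the quadratic term of the recursion is exactly half of the
   supersolution 2 * l * C * g, since 4 * l ^+ 2 * C ^+ 3 * K * S = l * C. *)
pose l := (L * S)^-1.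
have LS0 : 0 < L * S by rewrite mulr_gt0//; lra.
have l0 : 0 < l by rewrite invr_gt0.
have l1 : l <= 1 by rewrite invf_le1//; nra.
have lLS : l * (L * S) = 1 by rewrite mulVf// gt_eqF.
pose g y := \sum_(i : I) kernel_g alpha y (pts i).
have g0 y : 0 <= g y by apply: sumr_ge0 => i _; apply: kernel_ge0.
have gS y : g y <= 2 * S.
  apply: le_trans (_ : _ <= 2 * kernel_g_set b y A) _; last by rewrite ler_pM2l.
  by rewrite -sumE mulr_sumr; apply: ler_sum => i _; apply: kernel_le_kernel; lra.
have hF : moment_sum G pts l #|{: I}| x <= 2 * l * C * g x.
  apply: (@moment_sum_supersolution _ _ _ _ _ hV G hBK
    (fun x y => C * kernel_g alpha x y) tauC _ _ _ (fun y => 2 * l * C * g y)).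
  - exact: ltW.
  - by move=> y; rewrite !mulr_ge0// ltW.
  move=> y ws uws.
  have conv' : \sum_(w <- ws) kernel_g alpha y w * g w ^+ 2 <= K * S * g y.
    apply: le_trans (_ : _ <= K1 * S * g y) _.
      by apply: conv => // z; rewrite sumE.
    by rewrite -!mulrA ler_wpM2r// mulr_ge0// ltW.
  have -> : \sum_(w <- ws) C * kernel_g alpha y w * (2 * l * C * g w) ^+ 2 =
      4 * l ^+ 2 * C ^+ 3 * \sum_(w <- ws) kernel_g alpha y w * g w ^+ 2.
    rewrite mulr_sumr; apply: eq_bigr => w _.
    move: (kernel_g _ _ _) (g w) => k v; nra.
  rewrite -mulr_sumr -/(g y).
  have : 4 * l ^+ 2 * C ^+ 3 * \sum_(w <- ws) kernel_g alpha y w * g w ^+ 2 <=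
      4 * l ^+ 2 * C ^+ 3 * (K * S * g y).
    by apply: ler_wpM2l conv'; rewrite !mulr_ge0 ?exprn_ge0 ?ltW.
  have -> : 4 * l ^+ 2 * C ^+ 3 * (K * S * g y) = l * (L * S) * (l * C * g y).
    by rewrite /L; nra.
  rewrite lLS; lra.
have hF1 : moment_sum G pts l #|{: I}| x <= 1.
  apply: le_trans hF _; apply: (@le_trans _ _ (2 * l * C * (2 * S))).
    by rewrite ler_wpM2l ?gS// !mulr_ge0// ltW.
  apply: (@le_trans _ _ (l * (L * S))); last by rewrite lLS.
  have -> : 2 * l * C * (2 * S) = 4 * l * C * S * 1 by lra.
  have -> : l * (L * S) = 4 * l * C * S * (C * K) by rewrite /L; lra.
  by rewrite ler_wpM2l// !mulr_ge0// ltW.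
have cL : c <= (2 * L)^-1 by rewrite lef_pV2 ?posrE; lra.
have cK2 : c * K2 <= 1.
  by rewrite /c mulrC ler_pdivrMr; lra.
split.
  have mX := @measurable_cluster_tail R V A x t hV fA.
  have mGX := measurable_preimage G mX.
  rewrite -(probE _ mGX) lee_fin.
  have main : expR (l / 2 * t) * prob P (G @^-1`
      [set H | t < (card_set (graph_cluster H x `&` A))%:R]) <= 2.
    apply: (reached_count_tail hV (G := G) (pts := pts) (x := x)) => //.
    - by rewrite (ltW l0).
    - exact: ltW.
    move=> omega /= tX; have [D xD le] := card_cluster_reaches x (G omega) fA.
    by exists D => //; apply: le_trans (ltW tX) _; rewrite ler_nat.
  rewrite /tail mulNr expRN ler_pdivlMr ?expR_gt0// mulrC.
  apply: le_trans main; rewrite ler_wpM2r ?prob_ge0// ler_expR.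
  rewrite mulrA mulrAC ler_pM2r//.
  apply: le_trans (_ : _ <= (2 * L)^-1 / S) _; first by rewrite ler_pM2r ?invr_gt0.
  by rewrite /l -!invfM; rewrite lef_pV2 ?posrE; lra.
rewrite /tail ler_pM2l// ler_expR !mulNr lerN2.
set m := _ `^ _ in Sle *.
have m0 : 0 < m by rewrite -(pmulr_rgt0 _ K20); lra.
rewrite expr2 -mulrA ler_pM2l// mulrCA ler_pM2l//.
rewrite ler_pdivrMr// mulrC ler_pdivlMr//.
apply: le_trans (_ : _ <= c * (K2 * m)) _; first by rewrite ler_pM2l.
by rewrite mulrA ler_piMl// ltW.
Qed.
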